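(* Let $\mathbf V$ be a pseudovariety of monoids such that the Mal'cev product of $\mathbf A$ and $\mathbf V$ (in this order) equals $\mathbf V$. Then every finite subsemigroup of a free pro-$\mathbf V$ monoid is completely regular.
   Context: A pseudovariety of monoids is a class of finite monoids closed under finite direct products, submonoids and homomorphic images. A finite semigroup is aperiodic if all its subgroups (subsemigroups that are groups) are trivial; $\mathbf A$ denotes the aperiodic pseudovariety. The Mal'cev product of $\mathbf A$ and $\mathbf V$ (in this order) is the pseudovariety of monoids generated by the finite monoids $M$ admitting a homomorphism $\varphi:M\to N$ with $N\in\mathbf V$ such that for each idempotent $e\in N$ the semigroup $\varphi^{-1}(e)$ is aperiodic. A pro-$\mathbf V$ monoid is a topological monoid that is a projective limit of (discrete) members of $\mathbf V$. For a topological space $X$, the free pro-$\mathbf V$ monoid on $X$ is the pro-$\mathbf V$ monoid $\widehat{F_{\mathbf V}}(X)$ equipped with a continuous map $X\to\widehat{F_{\mathbf V}}(X)$ such that every continuous map from $X$ to a pro-$\mathbf V$ monoid $M$ extends uniquely to a continuous monoid homomorphism $\widehat{F_{\mathbf V}}(X)\to M$. A finite semigroup $S$ is completely regular if each $s\in S$ satisfies $s^m=s$ for some integer $m>1$. *)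

(* Defs.v *)
From HB Require Import structures.
From mathcomp Require Import all_boot.
From mathcomp Require Import all_classical.
From mathcomp Require Import topology.

Set Implicit Arguments.
Unset Strict Implicit.
Unset Printing Implicit Defensive.

Local Open Scope classical_set_scope.
Local Open Scope group_scope.

(** Subsemigroups of a monoid are represented by their carriers, as sets; they
    need not contain the unit of the ambient monoid. *)
Section Subsemigroups.
Variable M : monoidType.
Implicit Types G S : set M.

Definition subsemigroup S := forall x y, S x -> S y -> S (x * y).

(** The identity [e] of a subgroup is an idempotent of [M] that may differ
    from [1]. *)
Definition subgroup G :=
  subsemigroup G /\
  exists e, [/\ G e, forall x, G x -> e * x = x /\ x * e = x
    & forall x, G x -> exists y, [/\ G y, x * y = e & y * x = e]].

Definition aperiodic S :=
  forall G, G `<=` S -> subgroup G -> exists e, G = [set e].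

Definition completely_regular S :=
  forall s, S s -> exists m : nat, (1 < m)%N /\ s ^+ m = s.

End Subsemigroups.

(** Closure under submonoids and under homomorphic images is stated through
    injective and surjective morphisms, so a pseudovariety is in particular
    invariant under isomorphism.  The empty product gives [pv_trivial]. *)
Record pseudovariety (V : monoidType -> Prop) : Prop := {
  pv_finite : forall M, V M -> finite_set [set: M];
  pv_trivial : forall M : monoidType, (forall x : M, x = 1) -> V M;
  pv_prod : forall M N : monoidType, V M -> V N -> V (M * N)%type;
  pv_sub : forall (M N : monoidType) (f : N -> M),
    monoid_morphism f -> injective f -> V M -> V N;
  pv_image : forall (M N : monoidType) (f : M -> N),
    monoid_morphism f -> (forall y, exists x, f x = y) -> V M -> V N }.

Definition generated_pseudovariety (C : monoidType -> Prop) (M : monoidType) :=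
  forall W, pseudovariety W -> (forall N, C N -> W N) -> W M.

Definition aperiodic_over (V : monoidType -> Prop) (M : monoidType) :=
  finite_set [set: M] /\
  exists (N : monoidType) (phi : M -> N),
    [/\ V N, monoid_morphism phi
      & forall e : N, e * e = e -> aperiodic (phi @^-1` [set e])].

(** The Mal'cev product of the aperiodic pseudovariety and [V], in this
    order. *)
Definition malcev_aperiodic (V : monoidType -> Prop) : monoidType -> Prop :=
  generated_pseudovariety (aperiodic_over V).

HB.structure Definition PreTopologicalMonoid :=
  {M of Monoid M & Topological M}.

HB.mixin Record PreTopologicalMonoid_isTopologicalMonoid M
    of PreTopologicalMonoid M := {
  mulg_continuous : continuous (fun x : M * M => x.1 * x.2)
}.

#[short(type="topologicalMonoidType")]
HB.structure Definition TopologicalMonoid :=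
  {M of PreTopologicalMonoid M & PreTopologicalMonoid_isTopologicalMonoid M}.

Record inverse_system := InverseSystem {
  idx : Type;
  idx_le : idx -> idx -> Prop;
  idx_refl : forall i, idx_le i i;
  idx_trans : forall i j k, idx_le i j -> idx_le j k -> idx_le i k;
  idx_inhabited : inhabited idx;
  idx_directed : forall i j, exists k, idx_le i k /\ idx_le j k;
  obj : idx -> monoidType;
  tr : forall i j, idx_le i j -> obj j -> obj i;
  tr_morphism : forall i j (ij : idx_le i j), monoid_morphism (tr ij);
  tr_id : forall i (ii : idx_le i i) x, tr ii x = x;
  tr_comp : forall i j k (ij : idx_le i j) (jk : idx_le j k) (ik : idx_le i k) x,
    tr ij (tr jk x) = tr ik x }.

Definition obj_prod (D : inverse_system) : topologicalType :=
  prod_topology (fun i : idx D => discrete_topology (obj i)).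

Definition threads (D : inverse_system) : set (obj_prod D) :=
  [set x | forall i j (ij : idx_le i j), tr ij (x j) = x i].
Arguments threads : clear implicits.

(** [M] is isomorphic, as a topological monoid, to the submonoid [threads D] of
    the product of the discrete monoids [obj i], with the subspace topology. *)
Definition projective_limit (D : inverse_system) (M : topologicalMonoidType) :=
  exists h : M -> obj_prod D,
    [/\ forall i, monoid_morphism (fun x => h x i : obj i),
        injective h,
        range h = threads D
      & forall U : set M, open U <-> exists2 B, open B & U = h @^-1` B].

Definition pro (V : monoidType -> Prop) (M : topologicalMonoidType) :=
  exists D : inverse_system,
    (forall i : idx D, V (obj i)) /\ projective_limit D M.

Definition free_pro (V : monoidType -> Prop) (X : topologicalType)
    (F : topologicalMonoidType) (iota : X -> F) :=
  [/\ pro V F,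
      continuous iota
    & forall (M : topologicalMonoidType) (f : X -> M),
        pro V M -> continuous f ->
        exists! g : F -> M,
          [/\ continuous g, monoid_morphism g & forall x, g (iota x) = f x]].

(* Main.v *)
Require Import Defs.
From HB Require Import structures.
From mathcomp Require Import all_boot.
From mathcomp Require Import all_classical.
From mathcomp Require Import topology.

Local Open Scope classical_set_scope.
Local Open Scope group_scope.

(** Let [s] lie in a finite subsemigroup of [F].  Its powers repeat, so [s] has
    an index [n] and a period [d]: [s ^+ (n + d) = s ^+ n] with [n > 0] least.
    If [n = 1] there is nothing to prove, so suppose [n > 1].  As [F] is
    pro-[V], some continuous morphism [f : F -> M] with [M] in [V] separates
    [s ^+ n.-1] from [s ^+ (n.-1 + d)]; hence [f s] still has index [n] in the
    finite monoid [M], and this forces [f s ^+ n.-1] to lie outside the ideal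
    [I] generated by [f s ^+ n] ([expg_drop_ideal]).

    The proof builds a finite monoid [E] with a surjective morphism to [M] such
    that the fibers over idempotents are aperiodic ([aperiodic_root_fiber])
    and no preimage of [f s] in [E] has index at most [n] ([expansion_index]).
    Since [V] absorbs Mal'cev products with the aperiodic monoids, [E] is in
    [V]; since [F] is free, [f] lifts to a morphism [F -> E]
    ([free_pro_lift]).  The image of [s] under the lift is a preimage of [f s]
    which satisfies [t ^+ (n + d) = t ^+ n], a contradiction.

    The monoid [E] counts the entries into [I].  Imagine a machine which reads
    a word over [M] and stores the product of the letters read so far; when
    that product falls into [I], the machine increases a counter and restarts
    the product from the current letter.  The counter has the values 0 and 1,
    and a third, absorbing value.  An element of [E] is an element of [M]
    together with a transformation of the states which shares with the reading
    of a word the few properties that matter ([tracks]).  Let [t] be a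
    preimage of [f s].  The machine started at [1] reads [n.-1] copies of [t]
    without restarting, and restarts exactly once in the [n]-th copy; but
    reading [n] more copies moves the counter again, so [t ^+ n] differs from
    [t ^+ (n + d * n)].

    The fibers are aperiodic because a transformation which does not move the
    counter on a state is determined there by its element of [M].  Let [g] be
    in a subgroup, with identity [f], of the fiber over [e].  On the states
    fixed by [f] reading [e] does not move the counter, so that both [f] and
    [g] act there through [e] only; hence [g] is [f]. *)

(** * Finite sets *)

Lemma finite_set_functions (A B : choiceType) :
  finite_set [set: A] -> finite_set [set: B] -> finite_set [set: A -> B].
Proof.
move=> /finite_seqP[s sE] /finite_seqP[t tE].
have sP x : x \in s by have : [set` s] x by rewrite -sE.
have tP y : y \in t by have : [set` t] y by rewrite -tE.
pose extend (h : {ffun seq_sub s -> seq_sub t}) : A -> B :=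
  fun x => val (h (SeqSub (sP x))).
rewrite [X in finite_set X](_ : _ = range extend).
  by apply: finite_image; apply: finite_finset.
apply/esym; rewrite -subTset => f _.
exists [ffun x => SeqSub (tP (f (val x)))] => //.
by apply/funext => x; rewrite /extend ffunE.
Qed.

Lemma pigeonhole (T : choiceType) (A : set T) (u : nat -> T) :
  finite_set A -> (forall i, A (u i)) ->
  exists i d, u (i + d.+1)%N = u i.
Proof.
move=> /finite_seqP[s sE] Au.
have us i : u i \in s by have := Au i; rewrite sE.
pose v := [seq u i | i <- iota 0 (size s).+1].
have /(uniqPn (u 0)) [i [j [ij]]] : ~~ uniq v.
  apply/negP => /uniq_leq_size /(_ _) => /(_ s).
  rewrite size_map size_iota ltnn => le; apply: notF; apply: le.
  by move=> _ /mapP[i _ ->].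
rewrite size_map size_iota => jv.
rewrite !(nth_map 0%N) ?size_iota ?(ltn_trans ij) // !nth_iota ?(ltn_trans ij) //.
by move=> uE; exists i, (j - i.+1)%N; rewrite addnS -addSn subnKC.
Qed.

(** * Powers in monoids *)

Lemma monoid_morphismX (M N : monoidType) (f : M -> N) n x :
  monoid_morphism f -> f (x ^+ n) = f x ^+ n.
Proof. by case=> f1 fM; elim: n => [|n IH] //; rewrite !expgS fM IH. Qed.

Lemma expg_periodM {M : monoidType} (s : M) n d k :
  s ^+ (n + d) = s ^+ n -> s ^+ (n + d * k) = s ^+ n.
Proof.
by move=> E; elim: k => [|k IH]; rewrite ?muln0 ?addn0 // mulnS addnA expgnDr E -expgnDr.
Qed.

Definition principal_ideal {M : monoidType} (z : M) : set M :=
  [set x | exists a b, x = a * z * b].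

Lemma principal_ideal_id {M : monoidType} (z : M) : principal_ideal z z.
Proof. by exists 1, 1; rewrite mul1g mulg1. Qed.

Lemma principal_idealMl {M : monoidType} (z x y : M) :
  principal_ideal z y -> principal_ideal z (x * y).
Proof. by move=> [a [b ->]]; exists (x * a), b; rewrite !mulgA. Qed.

Lemma principal_idealMr {M : monoidType} (z x y : M) :
  principal_ideal z x -> principal_ideal z (x * y).
Proof. by move=> [a [b ->]]; exists a, (b * y); rewrite !mulgA. Qed.

(** In a finite monoid, if [s ^+ n] lies in the ideal generated by its successor
    then it is a left multiple [c * s ^+ n.+1], so that every period of
    [s ^+ n.+1] is already a period of [s ^+ n]. *)
Lemma expg_drop_ideal {M : monoidType} (s : M) n d :
  finite_set [set: M] -> s ^+ (n.+1 + d) = s ^+ n.+1 ->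
  principal_ideal (s ^+ n.+1) (s ^+ n) -> s ^+ (n + d) = s ^+ n.
Proof.
move=> finM sE [a [b abE]].
(* Iterating [s ^+ n = (a * s) * s ^+ n * b] and cancelling the repetition
   among the powers of [a * s] removes the right factor [b]. *)
have pump j : s ^+ n = (a * s) ^+ j * s ^+ n * b ^+ j.
  elim: j => [|j IH]; first by rewrite mul1g mulg1.
  by rewrite {1}IH {1}abE expgS expgSr (expgS b) !mulgA.
have [i [e eE]] := @pigeonhole M setT (fun j => (a * s) ^+ j) finM (fun=> I).
have snE : s ^+ n = (a * s) ^+ e.+1 * s ^+ n.
  by rewrite {1}(pump i) -eE addnC expgnDr -!mulgA [(a * s) ^+ i * _]mulgA -pump.
suff [c cE] : exists c, s ^+ n = c * s ^+ n.+1.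
  by rewrite expgnDr cE -mulgA -expgnDr sE.
by exists ((a * s) ^+ e * a); rewrite {1}snE expgSr expgS !mulgA.
Qed.

(** * The restart expansion *)

(** [Some (b, q)] has the counter at [b] and the product [q] in store; [None] is
    the absorbing state. *)
Definition state (M : monoidType) : Type := option (bool * M).

Definition level {M : monoidType} (x : state M) : nat :=
  if x is Some (b, _) then b else 2.

Definition crosses {M : monoidType} (z q m : M) :=
  ~ principal_ideal z q /\ principal_ideal z (q * m).

(** The third condition only asks that a crossing move the counter, which keeps
    [tracks] closed under composition.  The fourth one bounds the move when [m]
    is outside the ideal: a product restarted inside a factorization of [m] is
    a right factor of [m], so it stays outside the ideal as well. *)
Definition tracks {M : monoidType} (z m : M) (f : state M -> state M) :=
  [/\ f None = None,
      forall (b : bool) q, ~ crosses z q m -> f (Some (b, q)) = Some (b, q * m),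
      forall (b : bool) q, crosses z q m -> (b < level (f (Some (b, q))))%N
    & forall q, crosses z q m -> ~ principal_ideal z m ->
        exists a r, m = a * r /\ f (Some (false, q)) = Some (true, r)].

(** All pairs are taken, not only those generated by letters: the aperiodicity
    of the fibers and the growth of the index follow from [tracks] alone. *)
Record expansion (M : monoidType) (z : M) := Expansion {
  root : M;
  act : state M -> state M;
  expansionP : tracks z root act }.
Arguments Expansion {M z root act}.
Arguments root {M z}.
Arguments act {M z}.
Arguments expansionP {M z}.

Section Expansion.
Variables (M : monoidType) (z : M).
Local Notation E := (expansion M z).
Local Notation I := (principal_ideal z).
Implicit Types t u : E.

HB.instance Definition _ := gen_eqMixin E.
HB.instance Definition _ := gen_choiceMixin E.

Lemma expansion_eq t u : root t = root u -> act t = act u -> t = u.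
Proof.
case: t u => [m f mf] [m' f' mf'] /= mE fE.
by subst m' f'; rewrite (Prop_irrelevance mf mf').
Qed.

Lemma tracks_level {m f} x : tracks z m f -> (level x <= level (f x))%N.
Proof.
move=> [fN fO fI _]; case: x => [[b q]|]; last by rewrite fN.
by have [/fI/ltnW|/fO ->] /= := pselect (crosses z q m).
Qed.

Lemma tracks1 : tracks z 1 id.
Proof.
have nc q : ~ crosses z q 1 by rewrite /crosses mulg1 => -[].
by split=> [|b q _|b q /nc|q /nc] //; rewrite mulg1.
Qed.

(** Composition is taken in reading order: the machine reads [m] before [m']. *)
Lemma tracksM {m f m' f'} :
  tracks z m f -> tracks z m' f' -> tracks z (m * m') (f' \o f).
Proof.
move=> mf mf'; have [fN fO fI fS] := mf; have [fN' fO' fI' fS'] := mf'.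
split=> [|b q nc|b q [nq qI]|q [nq qI] nI] /=; first by rewrite fN.
- rewrite fO => [|[nq qI]]; last first.
    by apply: nc; split; rewrite // mulgA; apply: principal_idealMr.
  rewrite fO' ?mulgA // => -[nqm qI]; apply: nc; split; rewrite ?mulgA //.
  by move=> /(@principal_idealMr _ _ _ m).
- have [c|nc] := pselect (crosses z q m).
    exact: leq_trans (fI _ _ c) (tracks_level _ mf').
  rewrite fO // fI' //; split; rewrite -?mulgA // => qmI.
  exact: nc.
have nm : ~ I m by move=> /(@principal_idealMr _ _ _ m').
have nm' : ~ I m' by move=> /(@principal_idealMl _ _ m).
have [c|nc] := pselect (crosses z q m).
  have [a [r [mE ->]]] := fS _ c nm; exists a, (r * m').
  rewrite fO' ?mulgA ?mE // => -[_ /(@principal_idealMl _ _ a)].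
  by rewrite mulgA -mE.
rewrite fO //; have [|a [r [mE ->]]] := fS' (q * m) _ nm'.
  by split; rewrite -?mulgA // => qmI; apply: nc.
by exists (m * a), r; rewrite mE mulgA.
Qed.

Let one : E := Expansion tracks1.
Let mul t u : E := Expansion (tracksM (expansionP t) (expansionP u)).

Fact expansion_mulA : associative mul.
Proof. by move=> t u v; apply: expansion_eq => //=; rewrite mulgA. Qed.

Fact expansion_mul1 : left_id one mul.
Proof. by move=> t; apply: expansion_eq => //=; rewrite mul1g. Qed.

Fact expansion_mulr1 : right_id one mul.
Proof. by move=> t; apply: expansion_eq => //=; rewrite mulg1. Qed.

HB.instance Definition _ :=
  isMonoid.Build E expansion_mulA expansion_mul1 expansion_mulr1.

Lemma rootM : monoid_morphism (root : E -> M). Proof. by []. Qed.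

Lemma actM t u x : act (t * u) x = act u (act t x). Proof. by []. Qed.

Lemma expansion_finite : finite_set [set: M] -> finite_set [set: E].
Proof.
move=> finM.
have finB : finite_set [set: bool] := finite_finset.
have finS : finite_set [set: state M].
  have : finite_set ([set None] `|` Some @` [set: bool * M]).
    rewrite finite_setU; split=> //; apply: finite_image.
    by rewrite -setXTT; apply: finite_setX.
  by apply: sub_finite_set => -[x|] _; [right; exists x|left].
have finC : finite_set [set: M * (state M -> state M)].
  by rewrite -setXTT; apply: finite_setX => //; apply: finite_set_functions.
rewrite -(preimage_setT (fun t => (root t, act t))).
by apply: finite_preimage finC => t u _ _ [] /expansion_eq.
Qed.

(** Let [g] be in a subgroup with identity [f] over [e].  A state [x] fixed by
    [f] is not crossed by [e], since the counter would grow; hence [g] maps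
    [x] to the state that [f] maps it to, namely [x].  The image of [f] consists
    of such states, so [f * g = f]. *)
Lemma aperiodic_root_fiber (e : M) : aperiodic (root @^-1` [set e] : set E).
Proof.
move=> G Ge [_ [f [Gf fE _]]]; exists f; apply/seteqP; split=> [g Gg|_ ->] //.
have [fg _] := fE _ Gg.
apply: expansion_eq; first by rewrite (Ge _ Gg) (Ge _ Gf).
rewrite -fg; apply/funext => y; rewrite actM.
have : act f (act f y) = act f y by rewrite -actM (fE _ Gf).1.
move: (act f y) => x fx.
have [gN gO _ _] := expansionP g; have [_ fO fI _] := expansionP f.
case: x fx => [[b q]|] // fx.
have nc : ~ crosses z q e.
  by rewrite -[e](Ge _ Gf) => /(fI b); rewrite fx ltnn.
by rewrite gO (Ge _ Gg) //; move: fx; rewrite fO (Ge _ Gf).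
Qed.

(** Reading the single letter [m]. *)
Definition restart (m : M) (x : state M) : state M :=
  if x is Some (b, q) then
    if `[< crosses z q m >] then (if b then None else Some (true, m))
    else Some (b, q * m)
  else None.

Lemma tracks_restart m : tracks z m (restart m).
Proof.
split=> // [b q nc|b q c|q c _] /=; first by rewrite asboolF.
  by rewrite asboolT //; case: b.
by rewrite asboolT //; exists 1, m; rewrite mul1g.
Qed.

(** Copies of [t] are read from the initial state [Some (false, 1)]: up to the
    exponent [n.+1] the product stays outside the ideal, and the next copy
    restarts it, once, at a right factor [r] of [root t]. *)
Lemma expansion_index t n d :
  z = root t ^+ n.+2 -> ~ I (root t ^+ n.+1) -> t ^+ (n.+2 + d.+1) <> t ^+ n.+2.
Proof.
set s := root t => zE nI tE.
have rootX k : root (t ^+ k) = s ^+ k by apply: monoid_morphismX rootM.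
have nIs : ~ I s.
  by move=> /(@principal_idealMr _ _ _ (s ^+ n)); rewrite -expgS.
have start : act (t ^+ n.+1) (Some (false, 1)) = Some (false, s ^+ n.+1).
  have [_ fO _ _] := expansionP (t ^+ n.+1).
  by rewrite fO rootX ?mul1g // => -[_]; rewrite mul1g.
have [a [r [sE step]]] : exists a r,
    s = a * r /\ act (t ^+ n.+2) (Some (false, 1)) = Some (true, r).
  rewrite expgSr actM start; have [_ _ _] := expansionP t; apply=> //.
  by split=> //; rewrite -expgSr -zE; apply: principal_ideal_id.
(* The period is multiplied by [n.+2] so that the loop reads enough copies to
   bring the product [r] into the ideal. *)
have loop : act (t ^+ (d.+1 * n.+2)) (Some (true, r)) = Some (true, r).
  by rewrite -step -actM -expgnDr expg_periodM.
have [_ _ fI _] := expansionP (t ^+ (d.+1 * n.+2)).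
suff /(fI true) : crosses z r (root (t ^+ (d.+1 * n.+2))) by rewrite loop ltnn.
split=> [/(@principal_idealMl _ _ a)|]; first by rewrite -sE.
rewrite rootX mulSn expgnDr -zE mulgA.
by apply/principal_idealMr/principal_idealMl/principal_ideal_id.
Qed.

End Expansion.

(** * Discrete monoids and lifting from a free pro-V monoid *)

(** [proj_continuous] wants an index type with decidable equality, supplied here
    classically. *)
Lemma open_coordinate {J : Type} {K : J -> topologicalType} (i : J)
    (U : set (K i)) :
  open U -> open ((fun g : prod_topology K => g i) @^-1` U).
Proof.
pose J' : eqType := HB.pack J (gen_eqMixin J).
by move=> oU; apply: open_comp oU => g _; apply: (@proj_continuous J' K i g).
Qed.

Section DiscreteMonoid.
Variable M : monoidType.

Definition discrete_monoid : Type := discrete_topology M.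

HB.instance Definition _ := Monoid.copy discrete_monoid M.
HB.instance Definition _ := Topological.copy discrete_monoid (discrete_topology M).

Lemma discrete_monoid_open (U : set discrete_monoid) : open U.
Proof. exact: (@discrete_open (discrete_topology M)). Qed.

Lemma discrete_monoid_continuous (T : topologicalType) (f : discrete_monoid -> T) :
  continuous f.
Proof. by apply/continuousP => U _; apply: discrete_monoid_open. Qed.

Fact discrete_mulg_continuous :
  continuous (fun x : discrete_monoid * discrete_monoid => x.1 * x.2).
Proof.
move=> [x y] U /nbhs_singleton /= Uxy.
exists ([set x], [set y]) => /=; last by move=> [_ _] [/= -> ->].
by split; apply: open_nbhs_nbhs; split=> //; apply: discrete_monoid_open.
Qed.

HB.instance Definition _ :=
  PreTopologicalMonoid_isTopologicalMonoid.Build discrete_monoid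
    discrete_mulg_continuous.

Lemma discrete_monoid_pro (V : monoidType -> Prop) :
  V M -> pro V discrete_monoid.
Proof.
move=> VM.
(* The constant inverse system over a single index. *)
pose D := @InverseSystem unit (fun _ _ => True) (fun=> I) (fun _ _ _ _ _ => I)
  (inhabits tt) (fun _ _ => ex_intro _ tt (conj I I)) (fun=> M)
  (fun _ _ _ x => x) (fun _ _ _ => conj erefl (fun _ _ => erefl))
  (fun _ _ _ => erefl) (fun _ _ _ _ _ _ _ => erefl).
exists D; split=> //; exists (fun x _ => x); split=> //.
- by move=> x y /(congr1 (fun f => f tt)).
- apply/seteqP; split=> [_ [x _ <-] //|x Dx]; exists (x tt) => //.
  by apply/funext => -[].
move=> U; split=> [_|_]; last exact: discrete_monoid_open.
exists (@^~ tt @^-1` U); last by [].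
by apply: open_coordinate; apply: discrete_monoid_open.
Qed.

End DiscreteMonoid.

Lemma pro_separated (V : monoidType -> Prop) (F : topologicalMonoidType)
    (x y : F) : pro V F -> x <> y ->
  exists (M : monoidType) (f : F -> discrete_monoid M),
    [/\ V M, monoid_morphism f, continuous f & f x <> f y].
Proof.
move=> [D [VD [h [hM hI _ hO]]]] xy.
have [i hi] : exists i, h x i <> h y i.
  apply: contrapT => /forallNP E; apply: xy; apply: hI.
  apply: functional_extensionality_dep => i.
  by have /contrapT := E i.
exists (obj i), (fun x => h x i); split=> //.
apply/continuousP => U _.
rewrite (_ : _ @^-1` U = h @^-1` ((fun g : obj_prod D => g i) @^-1` U)) //.
apply/hO; exists ((fun g : obj_prod D => g i) @^-1` U) => //.
by apply: open_coordinate; apply: discrete_monoid_open.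
Qed.

(** A surjection between members of [V] can be lifted along because lifting the
    images of the generators suffices: the uniqueness part of freeness forces
    [p \o g] to be [f]. *)
Lemma free_pro_lift {V : monoidType -> Prop} {X : topologicalType}
    {F : topologicalMonoidType} {iota : X -> F} {M N : monoidType}
    (p : N -> M) (section : M -> N) (f : F -> discrete_monoid M) :
  free_pro V iota -> V M -> V N -> monoid_morphism p -> cancel section p ->
  monoid_morphism f -> continuous f ->
  exists g : F -> N, monoid_morphism g /\ forall x, p (g x) = f x.
Proof.
move=> [_ iotaC ext] VM VN [p1 pM] sectionK fM fC.
have fiC : continuous (f \o iota).
  by move=> x; apply: continuous_comp; [apply: iotaC|apply: fC].
pose sect : discrete_monoid M -> discrete_monoid N := section.
have liftC : continuous (sect \o (f \o iota)).
  by move=> x; apply: continuous_comp;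
    [apply: fiC|apply: discrete_monoid_continuous].
have [g [[gC gM gE] _]] := ext _ _ (discrete_monoid_pro _ _ VN) liftC.
have [h [_ hU]] := ext _ _ (discrete_monoid_pro _ _ VM) fiC.
pose pd : discrete_monoid N -> discrete_monoid M := p.
have pgf : pd \o g = f.
  rewrite -(hU (pd \o g)) ?(hU f) //; split.
  - by move=> x; apply: continuous_comp;
      [apply: gC|apply: discrete_monoid_continuous].
  - by split=> [|x y] /=; rewrite ?gM.1 ?gM.2 /pd ?p1 ?pM.
  - by move=> x /=; rewrite gE; apply: sectionK.
by exists g; split=> // x; rewrite -pgf.
Qed.

(** * Finite subsemigroups *)

Theorem theorem2 (V : monoidType -> Prop) (hV : pseudovariety V)
    (hAV : forall M : monoidType, malcev_aperiodic V M <-> V M)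
    (X : topologicalType) (F : topologicalMonoidType) (iota : X -> F)
    (hF : free_pro V iota)
    (S : set F) (hS : subsemigroup S) (hSfin : finite_set S) :
  completely_regular S.
Proof.
move=> s Ss.
have SX n : S (s ^+ n.+1) by elim: n => [|n IH] //; rewrite expgS; apply: hS.
have [i [d sE]] := pigeonhole _ _ _ hSfin SX.
pose P k := `[< s ^+ (k.+1 + d.+1) = s ^+ k.+1 >].
have exP : exists k, P k by exists i; apply/asboolP; rewrite addSn.
have [[|n] /asboolP Pn minn] := ex_minnP exP.
  by exists (1 + d.+1)%N; split; rewrite ?Pn.
have nPn : s ^+ (n.+1 + d.+1) <> s ^+ n.+1.
  by move=> E; have := minn n; rewrite ltnn => F0; apply: notF; apply/F0/asboolP.
have [proF _ _] := hF.
(* The index of [s] is [n.+2]; separating these two powers makes it the index of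
   [f s] as well. *)
have [M [f [VM fM fC fs]]] := pro_separated _ _ _ _ proF nPn.
have finM := pv_finite hV VM.
pose z := f s ^+ n.+2.
have VE : V (expansion M z).
  apply/hAV => W _; apply; split; first exact: expansion_finite.
  by exists M, root; split=> // e _; apply: aperiodic_root_fiber.
have [g [gM rootg]] := free_pro_lift root
  (fun m => Expansion (tracks_restart M z m)) f hF VM VE (rootM M z)
  (fun=> erefl) fM fC.
exfalso; apply: (@expansion_index M z (g s) n d).
- by rewrite rootg.
- rewrite rootg => zI; apply: fs; rewrite !(monoid_morphismX _ _ _ _ _ fM).
  apply: expg_drop_ideal => //.
  by rewrite -!(monoid_morphismX _ _ _ _ _ fM) Pn.
by rewrite -!(monoid_morphismX _ _ _ _ _ gM) Pn.
Qed.
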